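(* Let $q\ge 2$ be an integer, let $m\in\mathbb N$ be arbitrary, and suppose that $\{X_n\}_{n\ge1}$ is a stationary Markov chain of order $m-1$ with state space $\{0,\ldots,q-1\}$ and transition probabilities $\pi_{x_1,\ldots,x_m}$. Let $F$ be the cumulative distribution function of $X=\sum_{n=1}^\infty X_nq^{-n}$. Then either $F$ is the uniform CDF on $[0,1]$ or $F$ is singular. Moreover, $F$ is continuous if $\pi_{x_1,\ldots,x_m}<1$ for all $x_1,\ldots,x_m\in\{0,\ldots,q-1\}$.
   Context: $\mathbb N=\{1,2,\ldots\}$. The CDF is $F(x)=\mathrm P(X\le x)$, $x\in\mathbb R$. The uniform CDF on $[0,1]$ is the CDF with value $x$ at each $x\in[0,1]$ (it is $0$ for $x<0$ and $1$ for $x>1$). A function $F:\mathbb R\to\mathbb R$ is singular if $F'(x)$ exists and equals $0$ for Lebesgue almost every $x\in\mathbb R$ (continuity is not required). A process $\{X_n\}_{n\ge1}$ is stationary if $\{X_n\}_{n\ge1}$ and $\{X_n\}_{n\ge2}$ are identically distributed. For $m\in\mathbb N$, $\{X_n\}_{n\ge1}$ is a Markov chain of order $m-1$ if the $X_n$ are independent when $m=1$, and, when $m>1$, the conditional distribution of $X_n$ given $X_1,\ldots,X_{n-1}$ depends only on $X_{n-m+1},\ldots,X_{n-1}$ for all $n\ge m$. A stationary Markov chain of order $m-1$ is specified by initial probabilities $\pi(x_1,\ldots,x_{m-1})=\mathrm P(X_1=x_1,\ldots,X_{m-1}=x_{m-1})$ (nothing if $m=1$) and transition probabilities $\pi_{x_1,\ldots,x_m}=\mathrm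 P(X_m=x_m\mid X_1=x_1,\ldots,X_{m-1}=x_{m-1})$ (meaning $\pi_{x_1}=\mathrm P(X_1=x_1)$ if $m=1$), indexed by all $x_1,\ldots,x_m\in\{0,\ldots,q-1\}$, such that: - if $m=1$: $\pi_{x_1}\ge0$ and $\sum_{j=0}^{q-1}\pi_j=1$; - if $m>1$: $\pi(x_1,\ldots,x_{m-1})\ge0$, the sum of $\pi(j_1,\ldots,j_{m-1})$ over all $j_1,\ldots,j_{m-1}\in\{0,\ldots,q-1\}$ is $1$, $\pi_{x_1,\ldots,x_m}\ge0$, and $\sum_{j=0}^{q-1}\pi_{x_1,\ldots,x_{m-1},j}=1$; - if $m>1$: the initial distribution is invariant, i.e. $\sum_{j=0}^{q-1}\pi(j,x_2,\ldots,x_{m-1})\,\pi_{j,x_2,\ldots,x_m}=\pi(x_2,\ldots,x_m)$, where $\pi(j,x_2,\ldots,x_{m-1})$ is read as $\pi(j)$ if $m=2$. The finite dimensional probabilities are, for $n\ge m$, $\mathrm P(X_1=x_1,\ldots,X_n=x_n)=\pi(x_1,\ldots,x_{m-1})\prod_{j=m}^n\pi_{x_{j-m+1},\ldots,x_j}$, with $\pi(x_1,\ldots,x_{m-1}):=1$ if $m=1$. (Transition probabilities from histories of probability zero, i.e. $\pi_{x_1,\ldots,x_m}$ with $m>1$ and $\pi(x_1,\ldots,x_{m-1})=0$, are any numbers satisfying $\pi_{x_1,\ldots,x_m}\ge0$, $\sum_{j=0}^{q-1}\pi_{x_1,\ldots,x_{m-1},j}=1$, and the invariance identity $\sum_{j=0}^{q-1}\pi(j,x_2,\ldots,x_{m-1})\,\pi_{j,x_2,\ldots,x_m}=\pi(x_2,\ldots,x_m)$.)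 *)

(* Defs.v *)
From HB Require Import structures.
From mathcomp Require Import all_boot all_order all_algebra finmap.
From mathcomp Require Import all_classical all_reals all_analysis measurable_realfun.

Set Implicit Arguments.
Unset Strict Implicit.
Unset Printing Implicit Defensive.

Import Order.TTheory GRing.Theory Num.Theory.
Import numFieldNormedType.Exports.

Local Open Scope classical_set_scope.
Local Open Scope ring_scope.

(* Processes are indexed from 0: the variable written X_n (n >= 1) in the
   mathematics is [X n.-1] here.  A process with state space {0, ..., q-1} is a
   sequence of nat-valued random variables all of whose values are < q. *)

Section processes.
Context d (T : measurableType d) (R : realType) (P : probability T R).
Implicit Type X : nat -> {RV P >-> nat}.

(* The product sigma-algebra on sequences. *)
Definition seq_measurable : set (set (nat -> nat)) :=
  <<s \bigcup_n preimage_set_system setT (fun u : nat -> nat => u n)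
        measurable >>.

Definition stationary X : Prop :=
  forall A : set (nat -> nat), seq_measurable A ->
    P [set w | A (fun n => X n w)] = P [set w | A (fun n => X n.+1 w)].

Definition mutually_independent X : Prop :=
  forall (J : {fset nat}) (B : nat -> set nat),
    fine (P (\bigcap_(j in [set` J]) (X j @^-1` B j))) =
    \prod_(j <- J) fine (P (X j @^-1` B j)).

(* Only meaningful when [P B] is nonzero. *)
Definition cond_prob (A B : set T) : R := fine (P (A `&` B)) / fine (P B).

(* The event that the process starts with the word [x]. *)
Definition starts_with q X (x : seq 'I_q) : set T :=
  [set w | mkseq (fun i => X i w) (size x) = [seq val a | a <- x]].

(* Order [r]; transition words have length m = r + 1.
   [n] is the length of the whole past, so the next variable is [X n];
   [drop (n - r) x] is the word of the last [r] letters of the past. *)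
Definition markov_chain q (r : nat) X : Prop :=
  if r is 0 then mutually_independent X
  else forall n, (r <= n)%N -> forall (x y : n.-tuple 'I_q) (a : 'I_q),
    (0 < P (starts_with X x))%E -> (0 < P (starts_with X y))%E ->
    drop (n - r) x = drop (n - r) y ->
    cond_prob [set w | X n w = a] (starts_with X x) =
    cond_prob [set w | X n w = a] (starts_with X y).

(* For [r = 0] this is the constant 1, the empty word being the only one. *)
Definition initial_prob q r X (x : r.-tuple 'I_q) : R :=
  fine (P (starts_with X x)).

(* After a history of probability zero, [p] is only constrained by
   [tp_ge0], [tp_sum1] and [tp_invariant]. *)
Record transition_probabilities q r X (p : r.+1.-tuple 'I_q -> R) : Prop := {
  tp_cond : forall (x : r.-tuple 'I_q) (a : 'I_q),
    (0 < P (starts_with X x))%E ->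
    p [tuple of rcons x a] = cond_prob [set w | X r w = a] (starts_with X x) ;
  tp_ge0 : forall x, 0 <= p x ;
  tp_sum1 : forall x : r.-tuple 'I_q, \sum_(a < q) p [tuple of rcons x a] = 1 ;
  tp_invariant : (0 < r)%N -> forall y : r.-tuple 'I_q,
    \sum_(j < q) initial_prob X [tuple of belast j y] * p [tuple of j :: y] =
    initial_prob X y }.

Definition digit_sum (q : nat) X (w : T) : R :=
  limn (series (fun n => (X n w)%:R / q%:R ^+ n.+1 : R)).

End processes.

Section digit_sum_measurable.
Context d (T : measurableType d) (R : realType) (P : probability T R).
Variables (q : nat) (X : nat -> {RV P >-> nat}).

Let digit (n : nat) (w : T) : R := (X n w)%:R / q%:R ^+ n.+1.

Let digit_ge0 n w : 0 <= digit n w.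
Proof. by rewrite /digit divr_ge0// exprn_ge0. Qed.

Let measurable_digit n : measurable_fun setT (digit n).
Proof.
apply: measurable_funM => //.
by apply: (@measurableT_comp _ _ _ _ _ _ (fun k : nat => k%:R : R)).
Qed.

Let digit_sumE : digit_sum q X =
  fine \o (fun w => \sum_(0 <= n <oo) (digit n w)%:E)%E.
Proof.
apply/funext => w /=; rewrite /digit_sum -/(digit^~ w).
have nd : {homo (series (digit^~ w)) : m n / (m <= n)%N >-> m <= n}.
  apply/nondecreasing_seqP => n; rewrite /series/= big_nat_recr//=.
  by rewrite lerDl digit_ge0.
have E : (fun n => \sum_(0 <= k < n) (digit k w)%:E)%E =
   EFin \o series (digit^~ w).
  by apply/funext => n; rewrite sumEFin.
have [cv|dv] := pselect (cvgn (series (digit^~ w))).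
  by rewrite E EFin_lim.
rewrite E dvgP//=.
have := nondecreasing_dvgn_lt nd dv; move/cvgeryP/cvg_lim => ->//.
Qed.

Lemma measurable_digit_sum : measurable_fun setT (digit_sum q X).
Proof.
rewrite digit_sumE; apply: measurableT_comp => //.
apply: ge0_emeasurable_sum => [n w _ _|n _]; first by rewrite lee_fin.
exact/measurable_EFinP.
Qed.

HB.instance Definition _ :=
  isMeasurableFun.Build _ _ _ _ (digit_sum q X) measurable_digit_sum.

End digit_sum_measurable.

Definition uniform_cdf (R : realType) (x : R) : R :=
  if x < 0 then 0 else if 1 < x then 1 else x.

Definition singular (R : realType) (F : R -> R) : Prop :=
  {ae @lebesgue_measure R, forall x, derivable F x 1 /\ F^`()%classic x = 0}.

(* Main.v *)
(* For a word [s] of digits let [M s] be the probability that the process starts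
   with [s].  Stationarity makes the transition law the same at every time, so
   [M] is multiplied by a transition probability whenever a letter is appended.

   If every transition probability is 1/q, then stationarity forces
   [M s = q^-|s|], and [F] is uniform.  Otherwise the Hellinger affinity
   [\sum_(|s| = n) sqrt (M s / q^n)] between the law of the first n digits and
   the uniform law decays exponentially: by AM-GM one more letter never
   increases it, and the nonuniform transition row is reached from every history
   with positive weight.  By Markov's inequality and Borel-Cantelli, for almost
   every x all q-adic intervals of level n near x eventually have mass o(q^-n),
   and as an increment of [F] at scale q^-n only sees boundedly many of them,
   [F' x = 0].  Continuity follows from the same bound on increments. *)

Require Import Defs.
From mathcomp Require Import all_boot all_order all_algebra finmap ring lra zify.
From mathcomp Require Import all_classical all_reals all_analysis.

Import Order.TTheory GRing.Theory Num.Theory.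
Import numFieldNormedType.Exports.

Local Open Scope classical_set_scope.
Local Open Scope ring_scope.

(** * Affinity of a transition law with the uniform law *)

Section history.
Context {q r : nat}.

(** The window of the last [r] letters slides by one; for [r = 0] it stays empty, so the affinity
    recursion covers independent variables too. *)
Definition push (h : r.-tuple 'I_q) (a : 'I_q) : r.-tuple 'I_q :=
  [tuple of behead (rcons h a)].

(* The last [r] letters of [h0 ++ s]; hence the last [r] letters of [s], and
   independent of [h0], as soon as [r <= size s]. *)
Definition history (h0 : r.-tuple 'I_q) (s : seq 'I_q) : r.-tuple 'I_q :=
  foldl push h0 s.

Lemma history_rcons h0 s a :
  history h0 (rcons s a) = push (history h0 s) a.
Proof. by rewrite /history foldl_rcons. Qed.

Lemma val_history h0 s : history h0 s = drop (size s) (h0 ++ s) :> seq _.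
Proof.
elim/last_ind: s => [|s a IHs]; first by rewrite cats0 drop0.
rewrite history_rcons /= IHs -drop_rcons; last by rewrite size_cat leq_addl.
by rewrite -drop1 drop_drop add1n size_rcons rcons_cat.
Qed.

Lemma val_history_ge h0 s : (r <= size s)%N ->
  history h0 s = drop (size s - r) s :> seq _.
Proof.
move=> rs; rewrite val_history drop_cat size_tuple.
by rewrite ltnNge rs.
Qed.

Lemma history_tuple h0 (h : r.-tuple 'I_q) : history h0 h = h.
Proof.
by apply: val_inj; rewrite /= val_history_ge size_tuple// subnn drop0.
Qed.

End history.

Lemma sum_rcons_tuple (V : nmodType) (q n : nat) (f : seq 'I_q -> V) :
  \sum_(w : n.+1.-tuple 'I_q) f w =
  \sum_(w : n.-tuple 'I_q) \sum_(a < q) f (rcons w a).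
Proof.
rewrite pair_big /=.
pose g (wa : n.-tuple 'I_q * 'I_q) := [tuple of rcons wa.1 wa.2].
rewrite (reindex g) //=.
exists (fun w : n.+1.-tuple 'I_q =>
  ([tuple of belast (thead w) (behead w)], last (thead w) (behead w))) => w _ /=.
  case: w => w a; congr pair; [apply: val_inj|];
  case: w => -[|b w] //= i; by rewrite /thead ?(tnth_nth a) /= ?belast_rcons ?last_rcons.
apply: val_inj => /=; rewrite -lastI.
by case: w => -[|b w] //= i; rewrite /thead (tnth_nth b).
Qed.

Section affinity.
Context {R : rcfType} {q r : nat} (p : r.+1.-tuple 'I_q -> R).
Hypothesis p_ge0 : forall x, 0 <= p x.
Hypothesis p_sum1 :
  forall h : r.-tuple 'I_q, \sum_(a < q) p [tuple of rcons h a] = 1.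
Implicit Types (h : r.-tuple 'I_q) (a : 'I_q).

(** Summand of the Bhattacharyya coefficient between the transition row at [h] and the uniform law
    on digits. *)
Definition weight h a : R := Num.sqrt (p [tuple of rcons h a] / q%:R).

(* The sum, over all continuations of length [k] of the history [h], of the
   square root of (transition probability) * q^-k: the affinity between the
   law of the next [k] digits and the uniform law. *)
Fixpoint affinity (k : nat) h : R :=
  if k is k'.+1 then \sum_(a < q) weight h a * affinity k' (push h a) else 1.

Lemma weight_ge0 h a : 0 <= weight h a.
Proof. exact: sqrtr_ge0. Qed.

Let q_gt0 h : (0 < q)%N.
Proof.
rewrite lt0n; apply/eqP => q0; have := oner_neq0 R.
by rewrite -(p_sum1 h) big1 ?eqxx// => a _; have := ltn_ord a; lia.
Qed.

(** With [u], [v] the roots of the two probabilities, the defect is [(u - v) ^+ 2 / 2]. The equality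
    case is kept because it is what detects a nonuniform row. *)
Lemma weight_agm h a :
  weight h a <= (p [tuple of rcons h a] + q%:R^-1) / 2
    ?= iff (p [tuple of rcons h a] == q%:R^-1).
Proof.
have q0 : 0 <= q%:R^-1 :> R by rewrite invr_ge0.
have [u u0 uE] : exists2 u, 0 <= u & p [tuple of rcons h a] = u ^+ 2.
  by exists (Num.sqrt (p [tuple of rcons h a])); rewrite ?sqr_sqrtr ?sqrtr_ge0.
have [v v0 vE] : exists2 v, 0 <= v & q%:R^-1 = v ^+ 2 :> R.
  by exists (Num.sqrt q%:R^-1); rewrite ?sqr_sqrtr ?sqrtr_ge0.
rewrite /weight uE vE -exprMn sqrtr_sqr ger0_norm ?mulr_ge0//.
have D : (u ^+ 2 + v ^+ 2) / 2 - u * v = (u - v) ^+ 2 / 2 by field.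
split; first by rewrite -subr_ge0 D divr_ge0// sqr_ge0.
rewrite eq_sym -subr_eq0 D mulf_eq0 invr_eq0 pnatr_eq0 orbF sqrf_eq0 subr_eq0.
by rewrite eqrXn2.
Qed.

Lemma sum_weight_le1 h : \sum_(a < q) weight h a <= 1
  ?= iff [forall a, p [tuple of rcons h a] == q%:R^-1].
Proof.
have S : \sum_(a < q) (p [tuple of rcons h a] + q%:R^-1) / 2 = 1.
  rewrite -mulr_suml big_split/= p_sum1 sumr_const card_ord.
  by rewrite -[_^-1 *+ q]mulr_natl mulfV ?pnatr_eq0 -?lt0n ?(q_gt0 h)// divff.
by have := leif_sum (fun a (_ : predT a) => weight_agm h a); rewrite S.
Qed.

Lemma affinity_le1 k h : affinity k h <= 1.
Proof.
elim: k h => //= k IHk h; apply: le_trans (sum_weight_le1 h).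
by apply: ler_sum => a _; rewrite ler_piMr// weight_ge0.
Qed.

(** A nonuniform row at [h] already loses mass strictly. If the row is uniform, the letter [a] has
    positive weight, so the strict loss that follows it survives in the sum. *)
Lemma affinityS_lt1 k h a : affinity k (push h a) < 1 -> affinity k.+1 h < 1.
Proof.
move=> ka; have := sum_weight_le1 h.
set b := [forall a, _] => -[S1 Sb].
have [/forallP B|B] := boolP b; last first.
  apply: le_lt_trans (_ : \sum_(a < q) weight h a < 1).
    by apply: ler_sum => c _; rewrite ler_piMr ?weight_ge0 ?affinity_le1.
  by rewrite lt_neqAle S1 Sb B.
apply: lt_le_trans S1; rewrite /= (bigD1 a)//= [ltRHS](bigD1 a)//=.
apply: ltr_leD; last first.
  by apply: ler_sum => c _; rewrite ler_piMr ?weight_ge0 ?affinity_le1.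
rewrite gtr_pMr// /weight (eqP (B a)) sqrtr_gt0.
by rewrite divr_gt0 ?invr_gt0 ?ltr0n ?(q_gt0 h).
Qed.

(** The strict loss is carried backwards through [s], its last letter first. *)
Lemma affinity_history_lt1 k s h :
  affinity k (history h s) < 1 -> affinity (size s + k) h < 1.
Proof.
elim/last_ind: s k h => [|s a IHs] k h //.
rewrite history_rcons size_rcons addSnnS => /affinityS_lt1.
exact: IHs.
Qed.

Lemma affinityD (c : R) k l h : 0 <= c -> (forall h, affinity l h <= c) ->
  affinity (k + l) h <= affinity k h * c.
Proof.
move=> c0 lc; elim: k h => [|k IHk] h; first by rewrite mul1r.
rewrite addSn /= mulr_suml; apply: ler_sum => a _.
by rewrite -mulrA ler_wpM2l ?weight_ge0.
Qed.

(** Reading the [r] letters of [h0] turns any history into [h0], and the next letter meets a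
    nonuniform row. So [r.+1] letters lose strictly from every history, uniformly since there are
    finitely many histories. *)
Lemma affinity_decay : ~ (forall x, p x = q%:R^-1) ->
  exists2 rho : R, 0 < rho < 1 &
    forall j h, affinity (j * r.+1) h <= rho ^+ j.
Proof.
move=> /existsNP[x px].
have [h0 [a xE]] : exists h0 a, x = [tuple of rcons h0 a].
  exists [tuple of belast (thead x) (behead x)], (last (thead x) (behead x)).
  apply: val_inj => /=; rewrite -lastI.
  by case: (x) => -[|b w] //= i; rewrite /thead (tnth_nth b).
have lt1 h : affinity r.+1 h < 1.
  rewrite -addn1 -(size_tuple h0); apply: affinity_history_lt1.
  rewrite history_tuple /= (eq_bigr (weight h0)) => [|b _]; last by rewrite mulr1.
  rewrite (lt_leif (sum_weight_le1 h0)); apply/negP => /forallP/(_ a)/eqP.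
  by rewrite -xE.
(* The default [2^-1] gives positivity at once and still lies below 1. *)
pose rho := \big[Order.max/2^-1]_(h : r.-tuple 'I_q) affinity r.+1 h.
have rho_ge h : affinity r.+1 h <= rho by exact: le_bigmax.
have rho0 : 0 < rho.
  by apply: lt_le_trans (_ : 2^-1 <= _); rewrite ?invr_gt0 ?bigmax_ge_id.
exists rho.
  rewrite rho0 /=; apply/bigmax_ltP; split => [|h _]; last exact: lt1.
  by rewrite invf_lt1 ?ltr1n.
elim=> [|j IHj] h; first by rewrite expr0.
rewrite mulSn addnC exprSr.
apply: le_trans (affinityD rho _ _ _ (ltW rho0) rho_ge) _.
by rewrite ler_wpM2r// ltW.
Qed.

End affinity.

(** * Probabilities of words *)

Section words.
Context {R : realType} {d : measure_display} {T : measurableType d}.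
Context {P : probability T R} {q : nat} (X : nat -> {RV P >-> nat}).
Hypothesis X_lt : forall n w, (X n w < q)%N.
Implicit Types (s : seq 'I_q) (A : set T).

(** At [n = 0] this is convertible to [starts_with]. *)
Definition word_at n s : set T :=
  [set w | mkseq (fun i => X (n + i)%N w) (size s) = map val s].

Lemma mkseqS_rcons (f : nat -> nat) s (a : 'I_q) :
  (mkseq f (size (rcons s a)) = map val (rcons s a)) <->
  (mkseq f (size s) = map val s /\ f (size s) = a).
Proof.
rewrite size_rcons mkseqS map_rcons; split => [/rcons_inj[-> ->]//|[-> ->]//].
Qed.

Lemma word_at_rcons n s a : word_at n (rcons s a) =
  word_at n s `&` [set w | X (n + size s)%N w = a].
Proof. by apply/seteqP; split => w /= /mkseqS_rcons. Qed.

Lemma starts_with_rcons s a : starts_with X (rcons s a) =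
  starts_with X s `&` [set w | X (size s) w = a].
Proof. exact: (word_at_rcons 0). Qed.

Lemma starts_with_cat s1 s2 : starts_with X (s1 ++ s2) =
  starts_with X s1 `&` word_at (size s1) s2.
Proof.
elim/last_ind: s2 => [|s2 a IHs].
  by apply/seteqP; rewrite cats0; split => w //= [].
by rewrite -rcons_cat starts_with_rcons IHs word_at_rcons size_cat setIA.
Qed.

Lemma measurable_digit n (a : nat) : measurable [set w | X n w = a].
Proof. exact: (measurable_funPTI (X n) (Y := [set a])). Qed.

Lemma measurable_word_at n s : measurable (word_at n s).
Proof.
elim/last_ind: s => [|s a IHs]; last first.
  by rewrite word_at_rcons; apply: measurableI => //; exact: measurable_digit.
rewrite (_ : word_at n [::] = setT)//.
by apply/seteqP; split.
Qed.

Lemma measurable_starts_with s : measurable (starts_with X s).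
Proof. exact: (measurable_word_at 0). Qed.

Definition pr A : R := fine (P A).

Lemma pr_ge0 A : 0 <= pr A.
Proof. exact: fine_ge0. Qed.

Lemma EFin_pr A : measurable A -> P A = (pr A)%:E.
Proof. by move=> mA; rewrite fineK ?fin_num_measure. Qed.

Lemma le_pr A B : measurable A -> measurable B -> A `<=` B -> pr A <= pr B.
Proof.
by move=> mA mB AB; rewrite -lee_fin -!EFin_pr// le_measure ?inE.
Qed.

Lemma prT : pr setT = 1.
Proof. by rewrite /pr probability_setT. Qed.

Lemma starts_with_inj n (u v : n.-tuple 'I_q) w :
  starts_with X u w -> starts_with X v w -> u = v.
Proof.
rewrite /starts_with /= !size_tuple => -> uv.
by apply/val_inj/(inj_map val_inj).
Qed.

Lemma starts_with_total n w : exists u : n.-tuple 'I_q, starts_with X u w.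
Proof.
exists [tuple of mkseq (fun i => Ordinal (X_lt i w)) n].
rewrite /starts_with /= size_mkseq /mkseq -map_comp.
exact: eq_map.
Qed.

(** The events given by the initial words of length [n] partition the space, all digits being below
    [q]. *)
Lemma pr_sum_words n A : measurable A ->
  pr A = \sum_(u : n.-tuple 'I_q) pr (starts_with X u `&` A).
Proof.
move=> mA; apply: EFin_inj; rewrite -EFin_pr// -sumEFin.
have mI (u : n.-tuple 'I_q) : measurable (starts_with X u `&` A).
  by apply: measurableI => //; exact: measurable_starts_with.
under eq_bigr do rewrite -EFin_pr//.
have AE : A = \bigcup_(u in [set: n.-tuple 'I_q]) (starts_with X u `&` A).
  apply/seteqP; split => [w Aw|w [u _ []]//].
  by have [u uw] := starts_with_total n w; exists u.
rewrite {1}AE measure_fin_bigcup//.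
- rewrite [RHS]fsbig_seq ?index_enum_uniq//; apply: eq_fsbigl.
  by apply/seteqP; split => u //= _; exact: mem_index_enum.
- exact: finite_finset.
- by move=> u v _ _ [w [[uw _] [vw _]]]; exact: starts_with_inj uw vw.
Qed.

Lemma pr_word_at n s :
  pr (word_at n s) = \sum_(u : n.-tuple 'I_q) pr (starts_with X (u ++ s)).
Proof.
rewrite (pr_sum_words n); last exact: measurable_word_at.
by apply: eq_bigr => u _; rewrite starts_with_cat size_tuple.
Qed.

Lemma pr_starts_with_cat s1 s2 :
  pr (starts_with X (s1 ++ s2)) <= pr (starts_with X s1).
Proof.
rewrite starts_with_cat; apply: le_pr; last exact: subIsetl.
- by apply: measurableI; [exact: measurable_starts_with|exact: measurable_word_at].
- exact: measurable_starts_with.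
Qed.

(** Cylinders lie in the product sigma-algebra, which lets stationarity be applied to them. *)
Lemma seq_measurable_word n s :
  seq_measurable [set u | mkseq (fun i => u (n + i)%N) (size s) = map val s].
Proof.
elim/last_ind: s => [|s a IHs].
  rewrite (_ : [set _ | _] = setT); last by apply/seteqP; split.
  exact: (@measurableT _ (g_sigma_algebraType _)).
rewrite (_ : [set _ | _] =
   [set u | mkseq (fun i => u (n + i)%N) (size s) = map val s] `&`
   [set u | u (n + size s)%N = nat_of_ord a]); last first.
  by apply/seteqP; split => u /= /mkseqS_rcons.
apply: (@measurableI _ (g_sigma_algebraType _)) => //.
apply: sub_sigma_algebra; exists (n + size s)%N => //.
by exists [set nat_of_ord a] => //; rewrite setTI.
Qed.

Hypothesis X_stat : stationary X.

Lemma pr_word_at_stationary n s : pr (word_at n s) = pr (starts_with X s).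
Proof.
elim: n => [|n IHn] //; rewrite -IHn /pr.
exact: (congr1 fine (esym (X_stat _ (seq_measurable_word n s)))).
Qed.

Lemma pr_starts_with_sum n s :
  pr (starts_with X s) = \sum_(u : n.-tuple 'I_q) pr (starts_with X (u ++ s)).
Proof. by rewrite -pr_word_at pr_word_at_stationary. Qed.

Lemma pr_starts_with_nil : pr (starts_with X ([::] : seq 'I_q)) = 1.
Proof. by rewrite -prT; congr pr; apply/seteqP; split. Qed.

(** The product formulas over the first [size s] and the first [(size s).+1] indices differ by the
    factor of the last letter. *)
Lemma pr_independent_rcons s a : mutually_independent X ->
  pr (starts_with X (rcons s a)) =
  pr (starts_with X s) * pr [set w | X (size s) w = a].
Proof.
move=> indep.
pose c i := nth 0%N (map val (rcons s a)) i.
pose J n := [fset i | i in iota 0 n]%fset.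
have JE n i : (i \in J n) = (i < n)%N.
  by rewrite in_fset /= mem_iota.
have E n : (n <= (size s).+1)%N ->
    \bigcap_(j in [set` J n]) (X j @^-1` [set c j]) =
    starts_with X (take n (rcons s a)).
  move=> ns; apply/seteqP; split => [w H|w]; last first.
    rewrite /starts_with /= size_takel ?size_rcons// => H j /=.
    rewrite JE => jn; rewrite /c map_take in H *.
    by have /(congr1 (nth 0%N ^~ j)) := H; rewrite nth_mkseq// nth_take.
  rewrite /starts_with /= size_takel ?size_rcons//.
  apply: (@eq_from_nth _ 0%N); rewrite ?size_mkseq ?size_map ?size_takel ?size_rcons//.
  move=> i ilt; rewrite nth_mkseq// map_take nth_take//.
  by apply: H; rewrite /= JE.
have S : J (size s).+1 = (size s |` J (size s))%fset.
  by apply/fsetP => i; rewrite in_fset1U !JE ltnS leq_eqVlt.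
have := indep (J (size s)) (fun i => [set c i]).
have := indep (J (size s).+1) (fun i => [set c i]).
rewrite !E// -{1}(size_rcons s a) take_size -cats1 take_size_cat// cats1.
move=> H1 H2; rewrite /pr {}H1 {}H2 S big_fsetU1/=; last by rewrite JE ltnn.
rewrite mulrC; congr (_ * fine (P _)).
apply/seteqP; split => w /=; rewrite /c map_rcons nth_rcons size_map ltnn eqxx//.
Qed.

Context {r : nat} (p : r.+1.-tuple 'I_q -> R).
Hypothesis X_markov : markov_chain q r X.
Hypothesis X_tp : transition_probabilities X p.

Lemma pr_initial_rcons (h : r.-tuple 'I_q) a :
  pr (starts_with X (rcons h a)) = pr (starts_with X h) * p [tuple of rcons h a].
Proof.
(* If [h] is null, so is its extension, and both sides vanish. *)
have [h0|h0] := eqVneq (pr (starts_with X h)) 0.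
  rewrite h0 mul0r; apply/eqP; rewrite eq_le pr_ge0 andbT -h0 -cats1.
  exact: pr_starts_with_cat.
rewrite (tp_cond X_tp); last first.
  by rewrite EFin_pr ?lte_fin ?lt_neqAle 1?eq_sym ?h0 ?pr_ge0//; exact: measurable_starts_with.
rewrite /cond_prob -/(pr _) -/(pr _) mulrCA divff// mulr1.
by rewrite starts_with_rcons setIC size_tuple.
Qed.

(** The relation defining [p] concerns time [r] only; stationarity carries it to all later times. *)
Lemma pr_starts_with_markov (h0 : r.-tuple 'I_q) s a : (r <= size s)%N ->
  pr (starts_with X (rcons s a)) =
  pr (starts_with X s) * p [tuple of rcons (history h0 s) a].
Proof.
move=> rs; set h := history h0 s.
have [s0|s0] := eqVneq (pr (starts_with X s)) 0.
  rewrite s0 mul0r; apply/eqP; rewrite eq_le pr_ge0 andbT -s0 -cats1.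
  exact: pr_starts_with_cat.
have hE : h = drop (size s - r) s :> seq _ by exact: val_history_ge.
have sE : s = take (size s - r) s ++ h by rewrite hE cat_take_drop.
(* The event of [s] lies inside an occurrence of [h] at a later time, which by stationarity is as
   likely as [h] at the start. *)
have h_gt0 : 0 < pr (starts_with X h).
  rewrite lt_neqAle pr_ge0 andbT eq_sym; apply: contra s0 => /eqP hh0.
  rewrite -(pr_word_at_stationary (size s - r)) in hh0.
  rewrite eq_le pr_ge0 andbT -hh0; apply: le_pr.
  - exact: measurable_starts_with.
  - exact: measurable_word_at.
  - by rewrite {1}sE starts_with_cat size_takel ?leq_subr//.
(* In the independent case, stationarity gives the letter after [s] the law of the first letter. *)
have [r0|r0] := posnP r.
  have indep : mutually_independent X.
    by move: X_markov; rewrite /markov_chain; case: (r) r0.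
  have h_nil : h = [::] :> seq _ by apply: size0nil; rewrite size_tuple.
  rewrite pr_independent_rcons//; congr (_ * _).
  have h1 : pr (starts_with X h) = 1 by rewrite h_nil pr_starts_with_nil.
  have := pr_initial_rcons h a; rewrite h1 mul1r => <-.
  rewrite h_nil -(pr_word_at_stationary (size s)); congr pr.
  by rewrite word_at_rcons addn0; apply/seteqP; split => w //= [].
have mk : forall n, (r <= n)%N -> forall (x y : n.-tuple 'I_q) (a : 'I_q),
    (0 < P (starts_with X x))%E -> (0 < P (starts_with X y))%E ->
    drop (n - r) x = drop (n - r) y ->
    cond_prob P [set w | X n w = a] (starts_with X x) =
    cond_prob P [set w | X n w = a] (starts_with X y).
  by move: X_markov r0; rewrite /markov_chain; case: (r).
have cpE (y : seq 'I_q) : cond_prob P [set w | X (size y) w = a] (starts_with X y) =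
    pr (starts_with X (rcons y a)) / pr (starts_with X y).
  by rewrite /cond_prob starts_with_rcons setIC.
pose c := pr (starts_with X (rcons s a)) / pr (starts_with X s).
have P_gt0 (y : seq 'I_q) : pr (starts_with X y) != 0 -> (0 < P (starts_with X y))%E.
  move=> y0; rewrite EFin_pr; last exact: measurable_starts_with.
  by rewrite lte_fin lt_neqAle eq_sym y0 pr_ge0.
(* All non-null pasts of the length of [s] that end in [h] share the conditional probability [c];
   for null ones both sides vanish. *)
have cE (u : (size s - r).-tuple 'I_q) :
    pr (starts_with X (u ++ rcons h a)) = c * pr (starts_with X (u ++ h)).
  have su : size (u ++ h) = size s by rewrite size_cat !size_tuple subnK.
  have [y0|y0] := eqVneq (pr (starts_with X (u ++ h))) 0.
    rewrite y0 mulr0 -rcons_cat; apply/eqP; rewrite eq_le pr_ge0 andbT -y0 -cats1.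
    exact: pr_starts_with_cat.
  have ysz : size (u ++ h) == size s by apply/eqP.
  have := mk _ rs (in_tuple s) (Tuple ysz) a (P_gt0 _ s0) (P_gt0 _ y0).
  rewrite /= -hE drop_size_cat ?size_tuple// => /(_ erefl).
  rewrite cpE -{1}su cpE -rcons_cat /c => ->.
  by rewrite mulfVK.
(* [markov_chain] only compares pasts of the same length; averaging over all
   pasts ending in [h] and shifting by stationarity identifies [c] with [p]. *)
have : pr (starts_with X (rcons h a)) = c * pr (starts_with X h).
  rewrite (pr_starts_with_sum (size s - r)) (pr_starts_with_sum (size s - r) h).
  by rewrite mulr_sumr; apply: eq_bigr => u _; exact: cE.
rewrite pr_initial_rcons mulrC => /(mulIf (lt0r_neq0 h_gt0)) ->.
by rewrite /c mulrC mulfVK.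
Qed.

(** Letters at times before [r] have no transition law, so a block of [r] letters is put in front of
    [s] and summed out by stationarity. *)
Lemma pr_starts_with_uniform s : (0 < q)%N -> (forall x, p x = q%:R^-1) ->
  pr (starts_with X s) = q%:R^-1 ^+ size s.
Proof.
move=> q0 pq; pose h0 : r.-tuple 'I_q := [tuple of nseq r (Ordinal q0)].
have E (u : r.-tuple 'I_q) :
    pr (starts_with X (u ++ s)) = pr (starts_with X u) * q%:R^-1 ^+ size s.
  elim/last_ind: s => [|s a IHs]; first by rewrite cats0 mulr1.
  rewrite -rcons_cat (pr_starts_with_markov h0) ?size_cat ?size_tuple ?leq_addr//.
  by rewrite IHs pq size_rcons exprSr mulrA.
rewrite (pr_starts_with_sum r) (eq_bigr _ (fun u _ => E u)) -mulr_suml.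
rewrite (_ : \sum_u _ = 1) ?mul1r//.
rewrite -pr_starts_with_nil (pr_starts_with_sum r [::]).
by apply: eq_bigr => u _; rewrite cats0.
Qed.

End words.
Arguments pr {R d T} P A.

(** * Words and q-adic intervals *)

Section word_value.
Context {q : nat}.
Implicit Types s t : seq 'I_q.

(** Horner evaluation in base [q], most significant digit first. *)
Definition word_value s : nat := foldl (fun v (a : 'I_q) => v * q + a)%N 0%N s.

Lemma word_value_rcons s a : word_value (rcons s a) = (word_value s * q + a)%N.
Proof. by rewrite /word_value foldl_rcons. Qed.

Lemma word_value_lt s : (word_value s < q ^ size s)%N.
Proof.
elim/last_ind: s => [|s a IHs] //; rewrite word_value_rcons size_rcons expnSr.
apply: leq_trans (_ : (word_value s).+1 * q <= _)%N; last by rewrite leq_mul2r IHs orbT.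
by rewrite mulSn addnC ltn_add2r.
Qed.

Lemma word_value_inj s t : size s = size t -> word_value s = word_value t -> s = t.
Proof.
elim/last_ind: s t => [|s a IHs] t; first by move/esym/size0nil.
case/lastP: t => [|t b]; rewrite !size_rcons// => -[st].
rewrite !word_value_rcons => E.
have ab : a = b.
  by apply: val_inj; have := congr1 (modn^~ q) E; rewrite !modnMDl !modn_small.
move: E; rewrite ab => /addIn/eqP; rewrite eqn_mul2r => /orP[/eqP q0|/eqP E].
  by have := ltn_ord a; lia.
by rewrite (IHs t st E).
Qed.

(** Words of one length are determined by their value, so this counts integers between [x] and [y].
    The hypothesis keeps the bound nonnegative when there are none. *)
Lemma card_word_value {R : realType} n (x y : R) : x <= y + 1 ->
  #|[pred s : n.-tuple 'I_q | x <= (word_value s)%:R <= y]|%:R <= y - x + 1.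
Proof.
move=> xy; set A := [pred s | _].
have [->|/card_gt0P[s0 s0A]] := posnP #|A|; first by lra.
pose x' := Num.ceil x; pose y' := Num.floor y.
have AP (s : n.-tuple _) : s \in A -> x' <= (word_value s)%:Z <= y'.
  by rewrite inE => /andP[xs sy]; rewrite ceil_le_int floor_ge_int -!pmulrn xs.
pose N := `|y' - x'|%N.
pose f (s : n.-tuple 'I_q) : 'I_N.+1 := inord `|(word_value s)%:Z - x'|%N.
have fE (s : n.-tuple _) : s \in A -> f s = `|(word_value s)%:Z - x'|%N :> nat.
  move=> /AP /andP[xs sy]; rewrite /f inordK//; rewrite /N; lia.
have : (#|A| <= N.+1)%N.
  rewrite -[N.+1]card_ord -(@card_in_imset _ _ f) ?max_card//.
  move=> s t sA tA /(congr1 val) /=; rewrite !fE// => st.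
  have /andP[xs _] := AP _ sA; have /andP[xt _] := AP _ tA.
  have absI (z : int) (a b : nat) : z <= a%:Z -> z <= b%:Z ->
    `|a%:Z - z|%N = `|b%:Z - z|%N -> a = b by lia.
  apply/val_inj/word_value_inj; rewrite ?size_tuple//.
  exact: absI xs xt st.
rewrite -(ler_nat R) => /le_trans; apply.
have N' : N%:Z = y' - x' by have /andP[] := AP _ s0A; rewrite /N; lia.
rewrite -natr1 lerD2r pmulrn N' rmorphB /= lerB ?floor_le ?ceil_ge//.
Qed.

End word_value.

(** * Digit expansions and increments of the distribution function *)

Section digits.
Context {R : realType} {d : measure_display} {T : measurableType d}.
Context {P : probability T R} {q : nat} (X : nat -> {RV P >-> nat}).
Hypothesis q_ge2 : (2 <= q)%N.
Hypothesis X_lt : forall n w, (X n w < q)%N.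

Let q_gt0 : 0 < q%:R :> R. Proof. by rewrite ltr0n; lia. Qed.
Let qX_gt0 n : 0 < q%:R ^+ n :> R. Proof. by rewrite exprn_gt0. Qed.

Definition partial_sum w : R^nat :=
  series (fun n => (X n w)%:R / q%:R ^+ n.+1 : R).

Lemma partial_sum_word (s : seq 'I_q) w : starts_with X s w ->
  partial_sum w (size s) = (word_value s)%:R / q%:R ^+ size s.
Proof.
elim/last_ind: s => [|s a IHs]; first by rewrite /partial_sum seriesEnat/= big_geq// mul0r.
rewrite starts_with_rcons => -[/IHs + /= Xa].
rewrite /partial_sum !seriesEnat /= size_rcons big_nat_recr//= => ->.
rewrite Xa word_value_rcons natrD natrM exprS.
by field; rewrite !gt_eqF.
Qed.

(** A digit is at most [q - 1], and [(q - 1) / q^(k+1) = q^-k - q^-(k+1)] telescopes. *)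
Lemma partial_sum_tail w m n : (m <= n)%N ->
  partial_sum w m <= partial_sum w n <= partial_sum w m + q%:R ^- m - q%:R ^- n.
Proof.
move=> /subnK <-; elim: (n - m)%N => {n} [|n /andP[IH1 IH2]].
  by rewrite add0n lexx/=; lra.
rewrite addSn; set k := (n + m)%N in IH1 IH2 *.
have -> : partial_sum w k.+1 = partial_sum w k + (X k w)%:R / q%:R ^+ k.+1.
  by rewrite /partial_sum !seriesEnat /= big_nat_recr.
have D0 : 0 <= (X k w)%:R / q%:R ^+ k.+1 :> R by rewrite divr_ge0// ltW.
have D1 : (X k w)%:R / q%:R ^+ k.+1 <= q%:R ^- k - q%:R ^- k.+1 :> R.
  rewrite (_ : _ - _ = (q%:R - 1) / q%:R ^+ k.+1); last first.
    by rewrite exprS; field; rewrite !gt_eqF.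
  by rewrite ler_pM2r ?invr_gt0// lerBrDr natr1 ler_nat.
apply/andP; split; lra.
Qed.

(** The upper end is included because all later digits may equal [q - 1]. *)
Lemma digit_sum_bounds (s : seq 'I_q) w : starts_with X s w ->
  (word_value s)%:R / q%:R ^+ size s <= digit_sum q X w <=
  ((word_value s)%:R + 1) / q%:R ^+ size s.
Proof.
move=> sw; rewrite mulrDl mul1r -(partial_sum_word _ _ sw).
have cv : cvgn (partial_sum w).
  apply: nondecreasing_is_cvgn.
    by move=> m n mn; have /andP[] := partial_sum_tail w _ _ mn.
  exists (partial_sum w 0 + 1) => _ [n _ <-].
  have /andP[_ /le_trans] := partial_sum_tail w _ _ (leq0n n); apply.
  by rewrite expr0 invr1 lerBlDr lerDl invr_ge0 ltW.
rewrite /digit_sum -/(partial_sum w); apply/andP; split.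
- apply: limr_ge => //; exists (size s) => // n /= sn.
  by have /andP[] := partial_sum_tail w _ _ sn.
- apply: limr_le => //; exists (size s) => // n /= sn.
  have /andP[_ /le_trans] := partial_sum_tail w _ _ sn; apply.
  by rewrite lerBlDr lerDl invr_ge0 ltW.
Qed.

Lemma pr_le_words n (A : set T) (Q : pred (n.-tuple 'I_q)) : measurable A ->
  (forall (s : n.-tuple 'I_q) w, A w -> starts_with X s w -> Q s) ->
  pr P A <= \sum_(s : n.-tuple 'I_q | Q s) pr P (starts_with X s).
Proof.
move=> mA AQ; rewrite (pr_sum_words X X_lt n _ mA) [leRHS]big_mkcond/=.
apply: ler_sum => s _; case: ifPn => [_|nQ].
  apply: le_pr; last exact: subIsetl.
    by apply: measurableI => //; exact: measurable_starts_with.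
  exact: measurable_starts_with.
rewrite (_ : _ `&` _ = set0) ?/pr ?measure0//.
rewrite -subset0 => w [sw Aw].
by move/negP: nQ; apply; exact: AQ Aw sw.
Qed.

Definition digit_cdf (x : R) : R := fine (cdf (digit_sum q X : {RV P >-> R}) x).

Let mX x : measurable [set w | digit_sum q X w <= x].
Proof.
rewrite (_ : [set _ | _] = (digit_sum q X : {RV P >-> R}) @^-1` `]-oo, x]).
  exact: measurable_funPTI.
by apply/seteqP; split => w /=; rewrite in_itv.
Qed.

Lemma cdfE x : digit_cdf x = pr P [set w | digit_sum q X w <= x].
Proof.
by [].
Qed.

Lemma cdf_diff x y : x <= y ->
  digit_cdf y - digit_cdf x = pr P [set w | x < digit_sum q X w <= y].
Proof.
move=> xy; rewrite !cdfE; apply/eqP; rewrite subr_eq; apply/eqP/EFin_inj.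
have mD : measurable [set w | x < digit_sum q X w <= y].
  rewrite (_ : [set _ | _] =
    [set w | digit_sum q X w <= y] `\` [set w | digit_sum q X w <= x]).
    exact: measurableD.
  apply/seteqP; split => w /= => [/andP[xw ->]|[-> /negP]].
    by split=> //; apply/negP; rewrite -ltNge.
  by rewrite -ltNge andbT.
rewrite EFinD -!EFin_pr// -measureU//.
  congr (P _); apply/seteqP; split => w /=.
    by move=> ->; rewrite andbT; case: (leP (digit_sum q X w) x); [right|left].
  by move=> [/andP[]//|/le_trans]; apply.
rewrite -subset0 => w [/= /andP[+ _]]; by rewrite ltNge => /negP.
Qed.

Lemma cdf_setC x : 1 - digit_cdf x = pr P [set w | x < digit_sum q X w].
Proof.
rewrite cdfE; apply: EFin_inj; rewrite EFinB -!EFin_pr//.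
  rewrite -probability_setC//; congr (P _).
  by apply/seteqP; split => w /=; rewrite ltNge => /negP.
rewrite (_ : [set _ | _] = ~` [set w | digit_sum q X w <= x]); first exact: measurableC.
by apply/seteqP; split => w /=; rewrite ltNge => /negP.
Qed.

Lemma cdf_nondecr x y : x <= y -> digit_cdf x <= digit_cdf y.
Proof. by move=> xy; rewrite -subr_ge0 cdf_diff// pr_ge0. Qed.

(* The 5 is the largest number of integers in an interval of length 4. *)
Lemma cdf_increment_le n x h B : 0 <= B -> `|h| <= q%:R ^- n ->
  (forall s : n.-tuple 'I_q, `|(word_value s)%:R - q%:R ^+ n * x| <= 2 ->
    pr P (starts_with X s) <= B) ->
  `|digit_cdf (x + h) - digit_cdf x| <= 5 * B.
Proof.
move=> B0 hn HB; set c := q%:R ^+ n * x.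
have key y z : y <= z -> x - q%:R ^- n <= y -> z <= x + q%:R ^- n ->
    digit_cdf z - digit_cdf y <= 5 * B.
  move=> yz xy zx; rewrite cdf_diff//.
  have mD : measurable [set w | y < digit_sum q X w <= z].
    rewrite (_ : [set _ | _] = (digit_sum q X : {RV P >-> R}) @^-1` `]y, z]).
      exact: measurable_funPTI.
    by apply/seteqP; split => w /=; rewrite in_itv.
  (* The value lies at most 1 above [c] and, as the interval of [s] has length [q^-n], at most 2
     below; the window is made symmetric to fit the hypothesis on [s]. *)
  pose Q (s : n.-tuple 'I_q) := c - 2 <= (word_value s)%:R <= c + 2.
  have DQ (s : n.-tuple 'I_q) w : y < digit_sum q X w <= z -> starts_with X s w -> Q s.
    move=> /andP[yD Dz] /digit_sum_bounds; rewrite size_tuple => /andP[sD Ds].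
    have q1 : q%:R ^+ n * q%:R ^- n = 1 :> R by rewrite divff// gt_eqF.
    have H1 : (word_value s)%:R <= (x + q%:R ^- n) * q%:R ^+ n.
      by rewrite -ler_pdivrMr//; lra.
    have H2 : (x - q%:R ^- n) * q%:R ^+ n <= (word_value s)%:R + 1.
      by rewrite -ler_pdivlMr//; lra.
    move: H1 H2; rewrite mulrDl mulrBl ![_ * q%:R ^+ n]mulrC q1 -/c.
    rewrite /Q; lra.
  apply: le_trans (pr_le_words n _ Q mD DQ) _.
  apply: le_trans (_ : \sum_(s | Q s) B <= _).
    apply: ler_sum => s /andP[Q1 Q2]; apply: HB; rewrite ler_norml -/c; lra.
  rewrite sumr_const -[leLHS]mulr_natl.
  rewrite ler_wpM2r//.
  have := @card_word_value q R n (c - 2) (c + 2).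
  rewrite -/Q => /(_ ltac:(lra)); lra.
have [h0|h0] := leP 0 h.
  rewrite ger0_norm ?subr_ge0 ?cdf_nondecr ?lerDl//.
  rewrite ger0_norm// in hn; apply: key; lra.
rewrite ltr0_norm// in hn.
have hx : x + h <= x by lra.
rewrite distrC ger0_norm ?subr_ge0; last exact: cdf_nondecr.
apply: key; lra.
Qed.
End digits.
Arguments digit_cdf {R d T P} q X x.

(** * Uniformity, continuity and singularity criteria *)

Lemma expr_lt_eps {R : realType} (x e : R) : 0 <= x < 1 -> 0 < e ->
  exists n, x ^+ n < e.
Proof.
move=> /andP[x0 x1] e0.
have /cvgrPdist_lt/(_ e e0)[n _ /(_ n (leqnn n))] : (x ^+ n @[n --> \oo] --> (0 : R)).
  by apply: cvg_expr; rewrite ger0_norm.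
by rewrite /= sub0r normrN ger0_norm ?exprn_ge0// => ?; exists n.
Qed.

Lemma measure_bigsetU_le d (T : measurableType d) (R : realType)
    (mu : {measure set T -> \bar R}) (I : finType) (Q : pred I) (A : I -> set T) :
  (forall i, measurable (A i)) ->
  (mu (\big[setU/set0]_(i | Q i) A i) <= \sum_(i | Q i) mu (A i))%E.
Proof.
move=> mA; pose K (B : set T) (b : \bar R) := measurable B /\ (mu B <= b)%E.
suff [] : K (\big[setU/set0]_(i | Q i) A i) (\sum_(i | Q i) mu (A i))%E by [].
apply: (big_rec2 K) => [|i B b _ [mB Bb]]; first by split; rewrite ?measure0.
split; first exact: measurableU.
by apply: le_trans (measureU2 _ _ _) _ => //; rewrite leeD2l.
Qed.

Section conclusions.
Context {R : realType} {d : measure_display} {T : measurableType d}.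
Context {P : probability T R} {q : nat} (X : nat -> {RV P >-> nat}).
Hypothesis q_ge2 : (2 <= q)%N.
Hypothesis X_lt : forall n w, (X n w < q)%N.

Let q_gt0 : 0 < q%:R :> R. Proof. by rewrite ltr0n; lia. Qed.
Let qX_gt0 n : 0 < q%:R ^+ n :> R. Proof. by rewrite exprn_gt0. Qed.
Let qV_gt0 n : 0 < q%:R ^- n :> R. Proof. by rewrite invr_gt0. Qed.
Let qV_lt1 : 0 <= (q%:R^-1 : R) < 1.
Proof. by rewrite invr_ge0 ler0n invf_lt1// ltr1n. Qed.

Lemma qV_small (e : R) : 0 < e -> exists n, q%:R ^- n < e.
Proof. by move=> e0; have [n] := expr_lt_eps _ _ qV_lt1 e0; exists n; rewrite -exprVn. Qed.

Local Notation F := (digit_cdf q X).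

Lemma digit_sum_itv w : 0 <= digit_sum q X w <= 1.
Proof.
have [s ws] := starts_with_total X X_lt 0 w.
have := digit_sum_bounds X q_ge2 X_lt s w ws.
by rewrite (tuple0 s) /word_value /= expr0 add0r divr1 invr1 mul1r.
Qed.

(** Counting words of length [n] bounds [F x] and [1 - F x] from above, each up to an error [q^-n];
    together the bounds pin down [F x]. *)
Lemma cdf_uniform :
  (forall s : seq 'I_q, pr P (starts_with X s) = q%:R^-1 ^+ size s) ->
  F = @uniform_cdf R.
Proof.
move=> ME; apply/funext => x; rewrite /uniform_cdf.
case: ltP => [x0|x0].
  rewrite cdfE (_ : [set _ | _] = set0) ?/pr ?measure0//.
  by rewrite -subset0 => w /=; have /andP[] := digit_sum_itv w; lra.
case: ltP => [x1|x1].
  rewrite cdfE (_ : [set _ | _] = setT) ?prT//.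
  by apply/seteqP; split => w //= _; have /andP[] := digit_sum_itv w; lra.
have sumE n (Q : pred (n.-tuple 'I_q)) :
    \sum_(s : n.-tuple 'I_q | Q s) pr P (starts_with X s) = #|Q|%:R / q%:R ^+ n.
  under eq_bigr do rewrite ME size_tuple.
  by rewrite sumr_const -[LHS]mulr_natl exprVn.
have mD : measurable [set w | digit_sum q X w <= x].
  rewrite (_ : [set _ | _] = (digit_sum q X : {RV P >-> R}) @^-1` `]-oo, x]).
    exact: measurable_funPTI.
  by apply/seteqP; split => w /=; rewrite in_itv.
have mDC : measurable [set w | x < digit_sum q X w].
  rewrite (_ : [set _ | _] = (digit_sum q X : {RV P >-> R}) @^-1` `]x, +oo[).
    exact: measurable_funPTI.
  by apply/seteqP; split => w /=; rewrite in_itv/= andbT.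
have le_div n (c y : R) : c <= q%:R ^+ n * y + 1 -> c / q%:R ^+ n <= y + q%:R ^- n.
  by move=> h; rewrite ler_pdivrMr// mulrDl mulVf ?gt_eqF// [y * _]mulrC.
have ub n : F x <= x + q%:R ^- n.
  rewrite cdfE.
  pose Q (s : n.-tuple 'I_q) := (0 : R) <= (word_value s)%:R <= q%:R ^+ n * x.
  have xQ (s : n.-tuple 'I_q) w :
      digit_sum q X w <= x -> starts_with X s w -> Q s.
    move=> Dx /(digit_sum_bounds X q_ge2 X_lt); rewrite size_tuple => /andP[sD _].
    by rewrite /Q ler0n /= mulrC -ler_pdivrMr// (le_trans sD).
  apply: le_trans (pr_le_words X X_lt n _ Q mD xQ) _.
  rewrite sumE; apply: le_div.
  have := @card_word_value q R n 0 (q%:R ^+ n * x); rewrite subr0; apply.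
  by rewrite addr_ge0// mulr_ge0// ltW.
have lb n : 1 - F x <= 1 - x + q%:R ^- n.
  rewrite cdf_setC.
  (* The upper cut [q^n - 1] is the largest value of a word; without it the count would not reflect
     [1 - x]. *)
  pose Q (s : n.-tuple 'I_q) :=
    q%:R ^+ n * x - 1 <= (word_value s)%:R <= (q%:R ^+ n - 1 : R).
  have xQ (s : n.-tuple 'I_q) w :
      x < digit_sum q X w -> starts_with X s w -> Q s.
    move=> Dx /(digit_sum_bounds X q_ge2 X_lt); rewrite size_tuple => /andP[_ Ds].
    apply/andP; split; last first.
      rewrite lerBrDr natr1 -natrX ler_nat.
      by rewrite -[X in (_ < _ ^ X)%N](size_tuple s) word_value_lt.
    by rewrite lerBlDr mulrC -ler_pdivlMr//; lra.
  apply: le_trans (pr_le_words X X_lt n _ Q mDC xQ) _.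
  rewrite sumE; apply: le_div.
  have := @card_word_value q R n (q%:R ^+ n * x - 1) (q%:R ^+ n - 1).
  set c := q%:R ^+ n; have cx : c * x <= c by rewrite ler_piMr// ltW// qX_gt0.
  by move=> /(_ ltac:(lra)) /le_trans; apply; lra.
apply/eqP/eqP; apply/le_anti/andP; split; apply/ler_addgt0Pr => e e0;
  have [n ne] := qV_small _ e0; have := ub n; have := lb n; lra.
Qed.

Lemma cdf_continuous :
  (forall e : R, 0 < e -> exists n, forall s : n.-tuple 'I_q,
    pr P (starts_with X s) <= e) ->
  continuous F.
Proof.
move=> small x; apply/cvgrPdist_le => e e0.
have e5 : 0 < e / 5 by rewrite divr_gt0.
have [n ne] := small _ e5.
exists (q%:R ^- n) => //= y yx.
have -> : y = x + (y - x) by rewrite addrC subrK.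
rewrite distrC; apply: le_trans (cdf_increment_le X q_ge2 X_lt n x _ (e / 5) _ _ _) _.
- exact: ltW.
- by rewrite distrC ltW.
- by move=> s _; exact: ne.
- lra.
Qed.

(** * Singularity from geometric decay of the affinities *)

Section singularity.
Variables (L : nat -> nat) (m : nat) (rho C : R).
Hypothesis L_step : forall j, L j.+1 = (L j + m)%N.
Hypothesis rho01 : 0 < rho < 1.
Hypothesis sum_le : forall j,
  \sum_(s : (L j).-tuple 'I_q) Num.sqrt (pr P (starts_with X s) / q%:R ^+ L j)
    <= C * rho ^+ j.
Hypothesis m_gt0 : (0 < m)%N.

(** Splits the decay evenly: with threshold [eta ^+ j], Markov's inequality leaves
    [(rho / eta) ^+ j = eta ^+ j] for the measure. *)
Let eta := Num.sqrt rho.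
Let rho_gt0 : 0 < rho. Proof. by case/andP: rho01. Qed.
Let eta_gt0 : 0 < eta. Proof. by rewrite sqrtr_gt0. Qed.
Let eta2 : eta ^+ 2 = rho. Proof. by rewrite sqr_sqrtr// ltW. Qed.
Let eta_lt1 : eta < 1.
Proof. by rewrite -sqrtr1 ltr_sqrt//; case/andP: rho01. Qed.

(** Equivalent to a mass above [rho ^+ j / q%:R ^+ L j]; the root matches the terms of the
    affinity. *)
Definition heavy j : pred ((L j).-tuple 'I_q) := fun s =>
  eta ^+ j / q%:R ^+ L j < Num.sqrt (pr P (starts_with X s) / q%:R ^+ L j).

(** The points whose increments of [F] at scale [q^-(L j)] may involve [s]; hence the radius 2 of
    [cdf_increment_le]. *)
Definition word_itv j (s : (L j).-tuple 'I_q) : set R :=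
  `[((word_value s)%:R - 2) / q%:R ^+ L j, ((word_value s)%:R + 2) / q%:R ^+ L j]%classic.

Definition exceptional j : set R := \big[setU/set0]_(s | heavy j s) word_itv j s.

Lemma word_itvP j s x :
  word_itv j s x <-> `|(word_value s)%:R - q%:R ^+ L j * x| <= 2.
Proof.
rewrite /word_itv /= in_itv /= ler_pdivrMr// ler_pdivlMr// mulrC ler_norml.
by split => /andP[? ?]; apply/andP; split; lra.
Qed.

Lemma measurable_exceptional j : measurable (exceptional j).
Proof. by apply: bigsetU_measurable => s _; exact: measurable_itv. Qed.

Lemma measure_word_itv j s :
  lebesgue_measure (word_itv j s) = (4 / q%:R ^+ L j)%:E.
Proof.
rewrite /word_itv lebesgue_measure_itv /= lte_fin ltr_pM2r//.
by rewrite ifT ?ltrD2l; [rewrite -EFinD -mulrBl; congr (_ / _)%:E; lra|lra].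
Qed.

(** Markov's inequality: each interval has length [4 / q^(L j)], and heaviness bounds this by
    [4 / eta ^+ j] times the affinity term of its word. *)
Lemma measure_exceptional j :
  (lebesgue_measure (exceptional j) <= (4 * C * eta ^+ j)%:E)%E.
Proof.
apply: le_trans (measure_bigsetU_le _ _ _ _ _ _ _ _) _.
  by move=> s; exact: measurable_itv.
apply: le_trans (_ : \sum_(s | heavy j s) (4 / eta ^+ j *
    Num.sqrt (pr P (starts_with X s) / q%:R ^+ L j))%:E <= _)%E.
  apply: lee_sum => s hs; rewrite [leLHS]measure_word_itv lee_fin.
  rewrite -mulrA [_^-1 * _]mulrC -ler_pdivrMl//.
  rewrite ler_pdivlMr ?exprn_gt0//.
  apply: le_trans (ltW hs).
  by rewrite le_eqVlt; apply/orP; left; apply/eqP; field; rewrite gt_eqF.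
rewrite sumEFin lee_fin -mulr_sumr.
apply: le_trans (_ : 4 / eta ^+ j * (C * rho ^+ j) <= _).
  rewrite ler_wpM2l//; first by rewrite divr_ge0// exprn_ge0// ltW.
  apply: le_trans (sum_le j); rewrite [leLHS]big_mkcond/=; apply: ler_sum => s _.
  by case: ifP => // _; rewrite sqrtr_ge0.
rewrite -eta2 -exprM mulnC exprM le_eqVlt; apply/orP; left; apply/eqP.
by field; rewrite expf_neq0 ?gt_eqF.
Qed.

Let C_ge0 : 0 <= C.
Proof.
have := sum_le 0; rewrite expr0 mulr1; apply: le_trans.
by apply: sumr_ge0 => s _; exact: sqrtr_ge0.
Qed.

(** Borel-Cantelli, with a geometric series of ratio [eta < 1]. *)
Lemma limsup_exceptional_null : lebesgue_measure (lim_sup_set exceptional) = 0%E.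
Proof.
apply: lim_sup_set_cvg0; first exact: measurable_exceptional.
apply: le_lt_trans (ltry (4 * C / (1 - eta))).
apply: lime_le; first exact: is_cvg_nneseries.
apply: nearW => n.
apply: le_trans (_ : \sum_(0 <= j < n) (4 * C * eta ^+ j)%:E <= _)%E.
  by apply: lee_sum => j _; exact: measure_exceptional.
rewrite sumEFin lee_fin.
apply: (@geometric_le_lim R n (4 * C) eta) => //; first by rewrite mulr_ge0.
by rewrite gtr0_norm.
Qed.

Lemma light_words x : ~ lim_sup_set exceptional x ->
  exists J, forall j, (J <= j)%N -> forall s : (L j).-tuple 'I_q,
    `|(word_value s)%:R - q%:R ^+ L j * x| <= 2 ->
    pr P (starts_with X s) <= rho ^+ j / q%:R ^+ L j.
Proof.
move=> xN; apply: contrapT => H; apply: xN => n _; apply: contrapT => nE.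
apply: H; exists n => j nj s /word_itvP xs.
rewrite leNgt; apply/negP => lt; apply: nE; exists j => //.
rewrite /exceptional (bigD1 s)//=; first by left.
have D : eta ^+ j / q%:R ^+ L j =
    Num.sqrt (rho ^+ j / q%:R ^+ L j / q%:R ^+ L j).
  rewrite -eta2 -exprM mulnC exprM -mulrA -invfM -expr2 -expr_div_n sqrtr_sqr.
  by rewrite ger0_norm// divr_ge0// ?exprn_ge0// ltW.
rewrite /heavy D ltr_sqrt ?ltr_pM2r//.
by rewrite divr_gt0// (le_lt_trans _ lt)// divr_ge0// ?exprn_ge0// ltW.
Qed.

Let scale j : R := q%:R ^- L j.

Let scale_anti i j : (i <= j)%N -> scale j <= scale i.
Proof.
move=> /subnK <-; rewrite /scale lef_pV2 ?posrE//; apply: ler_weXn2l.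
  by rewrite ler1n ltnW.
by elim: (j - i)%N => // k IHk; rewrite addSn L_step; lia.
Qed.

Let scale_small (e : R) : 0 < e -> exists j, scale j < e.
Proof.
move=> /qV_small[n ne]; exists n; apply: le_lt_trans ne.
rewrite /scale lef_pV2 ?posrE//; apply: ler_weXn2l; first by rewrite ler1n ltnW.
by elim: n => // n IHn; rewrite L_step; lia.
Qed.

(** The first level finer than [t] is [j.+1]. Consecutive scales differ by the fixed factor [q^m],
    so [t] is comparable to both. *)
Lemma scale_exists J (t : R) : 0 < t -> t <= q%:R ^- L J ->
  exists2 j, (J <= j)%N & q%:R ^- L j.+1 < t /\ t <= q%:R ^- L j.
Proof.
rewrite -/(scale J) => t0 tJ.
have [n nt nmin] := ex_minnP (scale_small _ t0).
have Jn : (J < n)%N.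
  by rewrite ltnNge; apply/negP => /scale_anti/(le_trans tJ); rewrite leNgt nt.
case: n nt nmin Jn => // n nt nmin Jn; exists n => //; split => //.
by rewrite leNgt; apply/negP => /nmin; rewrite ltnn.
Qed.

(** For [h] between the scales of levels [j.+1] and [j], the difference quotient is at most
    [5 * q^m * rho ^+ j]. *)
Lemma cdf_derivative0 x : ~ lim_sup_set exceptional x ->
  derivable F x 1 /\ F^`()%classic x = 0.
Proof.
move=> /light_words[J HJ].
have cv : h^-1 *: (F (h + x) - F x) @[h --> 0^'] --> (0 : R).
  apply/cvgrPdist_le => e e0.
  have qm0 : 0 < 5 * q%:R ^+ m :> R by rewrite mulr_gt0.
  have [J' J'e] := @expr_lt_eps R rho (e / (5 * q%:R ^+ m))
    ltac:(case/andP: rho01; lra) (divr_gt0 e0 qm0).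
  pose K := maxn J J'.
  exists (q%:R ^- L K) => //= h /=; rewrite sub0r normrN => hK h0.
  have t0 : 0 < `|h| by rewrite normr_gt0.
  have [j Kj [jh hj]] := scale_exists K _ t0 (ltW hK).
  have Jj : (J <= j)%N by rewrite (leq_trans _ Kj)// leq_maxl.
  have B0 : 0 <= rho ^+ j / q%:R ^+ L j by rewrite divr_ge0// ?exprn_ge0// ltW.
  have incr := cdf_increment_le X q_ge2 X_lt (L j) x h _ B0 hj (HJ j Jj).
  rewrite sub0r normrN normrZ normfV (addrC h) mulrC ler_pdivrMr//.
  apply: le_trans incr _.
  apply: le_trans (_ : e * q%:R ^- L j.+1 <= _); last by rewrite ler_pM2l// ltW.
  have rj : rho ^+ j <= rho ^+ J'.
    apply: ler_wiXn2l; rewrite ?ltW//; first by case/andP: rho01.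
    by rewrite (leq_trans _ Kj)// leq_maxr.
  have : rho ^+ j <= e / (5 * q%:R ^+ m) by apply: le_trans rj (ltW J'e).
  rewrite L_step exprD ler_pdivlMr// => H.
  rewrite mulrA ler_pdivrMr// -mulrA.
  rewrite (_ : (q%:R ^+ L j * q%:R ^+ m)^-1 * q%:R ^+ L j = q%:R ^- m); last first.
    by field; rewrite !gt_eqF.
  by rewrite ler_pdivlMr// [5 * _]mulrC -mulrA.
have derE : (fun h : R => h^-1 *: ((F \o shift x) (h *: 1) - F x)) =
            (fun h : R => h^-1 *: (F (h + x) - F x)).
  by apply/funext => h /=; rewrite /GRing.scale /= mulr1.
split; first by rewrite /derivable derE; apply/cvg_ex; exists 0.
by rewrite /derive1; apply/cvg_lim.
Qed.

Lemma cdf_singular : singular F.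
Proof.
exists (lim_sup_set exceptional); split.
- apply: bigcap_measurable => [|n _]; first by exists 0%N.
  by apply: bigcup_measurable => j _; exact: measurable_exceptional.
- exact: limsup_exceptional_null.
- by move=> x /=; apply: contra_notP => /cdf_derivative0.
Qed.

End singularity.
End conclusions.

(** * Words of the Markov chain *)

Section markov_words.
Context {R : realType} {d : measure_display} {T : measurableType d}.
Context {P : probability T R} {q r : nat} (X : nat -> {RV P >-> nat}).
Context (p : r.+1.-tuple 'I_q -> R) (h0 : r.-tuple 'I_q).
Hypothesis X_lt : forall n w, (X n w < q)%N.
Hypothesis X_stat : stationary X.
Hypothesis X_markov : markov_chain q r X.
Hypothesis X_tp : transition_probabilities X p.

Let markov s a := pr_starts_with_markov X X_lt X_stat p X_markov X_tp h0 s a.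

(** The first [r] letters are bounded by 1, and each later one contributes a factor at most [c]. *)
Lemma pr_starts_with_le_expr (c : R) : 0 <= c -> (forall x, p x <= c) ->
  forall k (s : seq 'I_q), size s = (r + k)%N -> pr P (starts_with X s) <= c ^+ k.
Proof.
move=> c0 pc; elim=> [|k IHk] s.
  by rewrite expr0 -(pr_starts_with_nil (q := q) X) => _; exact: (pr_starts_with_cat X [::] s).
case/lastP: s => [|s a]; rewrite addnS ?size_rcons// => -[ss].
rewrite markov ?ss ?leq_addr// exprSr ler_pM ?pr_ge0 ?IHk//.
exact: tp_ge0 X_tp _.
Qed.

(** The affinity at length [n + k], with the last [k] letters summed through the recursion; for
    [n >= r] the cut can be moved. *)
Let affinity_sum n k : R := \sum_(s : n.-tuple 'I_q)
  Num.sqrt (pr P (starts_with X s) / q%:R ^+ n) * affinity p k (history h0 s).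

Lemma affinity_sumS n k : (r <= n)%N ->
  affinity_sum n.+1 k = affinity_sum n k.+1.
Proof.
move=> rn; rewrite /affinity_sum.
rewrite (sum_rcons_tuple _ _ _ (fun s => Num.sqrt (pr P (starts_with X s) / q%:R ^+ n.+1) *
  affinity p k (history h0 s))).
apply: eq_bigr => s _; rewrite [affinity p k.+1 _]/= mulr_sumr.
apply: eq_bigr => a _; rewrite history_rcons markov ?size_tuple// mulrA.
congr (_ * _); rewrite /weight -sqrtrM; last first.
  by rewrite divr_ge0 ?pr_ge0 ?exprn_ge0.
by rewrite exprSr invfM mulrACA.
Qed.

Lemma sum_sqrt_pr k : \sum_(s : (r + k).-tuple 'I_q)
    Num.sqrt (pr P (starts_with X s) / q%:R ^+ (r + k)) =
  \sum_(s : r.-tuple 'I_q)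
    Num.sqrt (pr P (starts_with X s) / q%:R ^+ r) * affinity p k s.
Proof.
transitivity (affinity_sum (r + k) 0).
  by apply: eq_bigr => s _; rewrite mulr1.
have E n l : (r <= n)%N -> affinity_sum (n + l) 0 = affinity_sum n l.
  elim: l n => [|l IHl] n rn; first by rewrite addn0.
  by rewrite addnS -addSn IHl ?affinity_sumS// leqW.
rewrite E//; apply: eq_bigr => s _; by rewrite history_tuple.
Qed.

End markov_words.

(** * The dichotomy and the continuity of the distribution function *)

Theorem theorem3p1 (R : realType) (d : measure_display) (T : measurableType d)
    (P : probability T R) (q : nat) (r : nat) (X : nat -> {RV P >-> nat})
    (p : r.+1.-tuple 'I_q -> R) :
  (2 <= q)%N ->
  (forall n w, (X n w < q)%N) ->
  stationary X ->
  markov_chain q r X ->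
  transition_probabilities X p ->
  let F : R -> R := fun x => fine (cdf (digit_sum q X : {RV P >-> R}) x) in
  (F = @uniform_cdf R \/ singular F) /\
  ((forall x, p x < 1) -> continuous F).
Proof.
move=> q2 X_lt X_stat X_markov X_tp; rewrite -/(digit_cdf q X) => F.
have q0 : (0 < q)%N by lia.
pose h0 : r.-tuple 'I_q := [tuple of nseq r (Ordinal q0)].
have p0 x : 0 <= p x by exact: tp_ge0 X_tp x.
have p1 := tp_sum1 X_tp.
split.
  have [pq|pq] := pselect (forall x, p x = q%:R^-1).
    left; apply: cdf_uniform => // s.
    exact: (pr_starts_with_uniform X X_lt X_stat p X_markov X_tp s q0 pq).
  right; have [rho rho01 decay] := affinity_decay p p0 p1 pq.
  (* Levels consist of an initial history of [r] letters and [j] blocks of [r.+1] letters, each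
     block costing a factor [rho]; the constant is the affinity of the initial law. *)
  apply: (cdf_singular X q2 X_lt (fun j => r + j * r.+1)%N r.+1 rho
    (\sum_(s : r.-tuple 'I_q) Num.sqrt (pr P (starts_with X s) / q%:R ^+ r))) => //.
    by move=> j; rewrite mulSn; lia.
  move=> j; rewrite (sum_sqrt_pr X p h0)// mulr_suml.
  by apply: ler_sum => s _; rewrite ler_wpM2l ?sqrtr_ge0.
move=> p_lt1; apply: cdf_continuous => // e e0.
(* A maximum over finitely many words turns [p x < 1] into one bound [c < 1]. *)
pose c := \big[Order.max/0]_(x : r.+1.-tuple 'I_q) p x.
have c0 : 0 <= c by exact: bigmax_ge_id.
have c1 : c < 1 by apply/bigmax_ltP; split.
have [k ke] := expr_lt_eps c e ltac:(by rewrite c0 c1) e0.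
exists (r + k)%N => s; apply: le_trans (ltW ke).
apply: (pr_starts_with_le_expr X p h0) => //; last by rewrite size_tuple.
by move=> x; exact: le_bigmax.
Qed.
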